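(* Let $\Lambda$ be a $k$-graph, let $A$ be an abelian group, and let $f \in C^1(\Lambda,A)$. If $f \in Z^1(\Lambda,A)$ then there exists a unique element $\tilde f \in \underline{Z}^1(\Lambda,A)$ such that $\tilde f|_{Q_1(\Lambda)} = f$. Conversely, if $g \in \underline{Z}^1(\Lambda,A)$, then $g|_{Q_1(\Lambda)} \in Z^1(\Lambda,A)$. Finally, $f \in B^1(\Lambda,A)$ if and only if $\tilde f \in \underline{B}^1(\Lambda,A)$ (for $f\in Z^1(\Lambda,A)$, so that $\tilde f$ is defined), and the map $f \mapsto \tilde f$ induces an isomorphism $H^1(\Lambda,A) \cong \underline{H}^1(\Lambda,A)$.
   Context: $k$-graphs. For a nonnegative integer $k$, a $k$-graph is a nonempty countable small category $\Lambda$ with a functor $d:\Lambda\to\mathbb{N}^k$ (the degree; $0\in\mathbb{N}$) with the factorisation property: whenever $d(\lambda)=m+n$ with $m,n\in\mathbb N^k$ there are unique $\mu,\nu\in\Lambda$ with $d(\mu)=m$, $d(\nu)=n$, $\lambda=\mu\nu$. Elements of $\Lambda$ are the morphisms. Write $\Lambda^n=d^{-1}(n)$. The set $\Lambda^0$ is identified with the set of objects (identity morphisms), and $r,s:\Lambda\to\Lambda^0$ are codomain and domain; $\mu\nu$ is defined iff $s(\mu)=r(\nu)$. Let $e_1,\dots,e_k$ be the generators of $\mathbb{N}^k$, $|n|=\sum_i n_i$ and $|\lambda|=|d(\lambda)|$. Cubical cohomology. Let $Q_r(\Lambda)=\{\lambda\in\Lambda: d(\lambda)\le(1,\dots,1),\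 |\lambda|=r\}$ (empty for $r>k$). If $\lambda\in Q_r(\Lambda)$ has $d(\lambda)=e_{i_1}+\cdots+e_{i_r}$ with $i_1<\cdots<i_r$, then for $1\le j\le r$, $F_j^0(\lambda),F_j^1(\lambda)$ are the unique elements of $\Lambda^{d(\lambda)-e_{i_j}}$ such that $\lambda=F_j^0(\lambda)\beta=\alpha F_j^1(\lambda)$ for some $\alpha,\beta\in\Lambda^{e_{i_j}}$. $C^r(\Lambda,A)$ is the group of all functions $Q_r(\Lambda)\to A$, and $\delta^r:C^r(\Lambda,A)\to C^{r+1}(\Lambda,A)$ is $(\delta^r f)(\lambda)=\sum_{i=1}^{r+1}\sum_{\ell=0}^1(-1)^{i+\ell}f(F_i^\ell(\lambda))$. Put $Z^r=\ker\delta^r$, $B^r=\operatorname{Im}\delta^{r-1}$ for $r>0$, $B^0=0$, and $H^r=Z^r/B^r$. Categorical cohomology. Let $\Lambda^{*0}=\Lambda^0$ and, for $r\ge1$, $\Lambda^{*r}=\{(\lambda_1,\dots,\lambda_r)\in\Lambda^r: s(\lambda_i)=r(\lambda_{i+1})\text{ for all }i\}$ (here $\Lambda^r$ means $r$-fold cartesian power). $\underline{C}^r(\Lambda,A)$ is the group of functions $f:\Lambda^{*r}\to A$ with $f(\lambda_1,\dots,\lambda_r)=0$ whenever some $\lambda_i\in\Lambda^0$ (no condition when $r=0$). Define $(\underline{\delta}^0f)(\lambda)=f(s(\lambda))-f(r(\lambda))$ and, for $r\ge1$, $(\underline{\delta}^rf)(\lambda_0,\dots,\lambda_r)=f(\lambda_1,\dots,\lambda_r)+\sum_{i=1}^r(-1)^if(\lambda_0,\dots,\lambda_{i-2},\lambda_{i-1}\lambda_i,\lambda_{i+1},\dots,\lambda_r)+(-1)^{r+1}f(\lambda_0,\dots,\lambda_{r-1})$.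 Put $\underline{Z}^r=\ker\underline{\delta}^r$, $\underline{B}^r=\operatorname{Im}\underline{\delta}^{r-1}$, $\underline{H}^r=\underline{Z}^r/\underline{B}^r$. *)

(* Defs.v *)
From HB Require Import structures.
From mathcomp Require Import all_boot all_order all_algebra.
From mathcomp Require Import all_classical.

Set Implicit Arguments.
Unset Strict Implicit.
Unset Printing Implicit Defensive.

Import GRing.Theory.
Local Open Scope ring_scope.

(* [comp mu nu] is the composite of [mu] and [nu] when [src mu = tgt nu]; its
   value on other pairs is unconstrained and never used. *)
Record category := Category {
  obj : countType;
  mor :> countType;
  tgt : mor -> obj;
  src : mor -> obj;
  ident : obj -> mor;
  comp : mor -> mor -> mor;
  tgt_ident : forall v, tgt (ident v) = v;
  src_ident : forall v, src (ident v) = v;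
  tgt_comp : forall mu nu, src mu = tgt nu -> tgt (comp mu nu) = tgt mu;
  src_comp : forall mu nu, src mu = tgt nu -> src (comp mu nu) = src nu;
  comp1m : forall mu, comp (ident (tgt mu)) mu = mu;
  compm1 : forall mu, comp mu (ident (src mu)) = mu;
  compA : forall la mu nu, src la = tgt mu -> src mu = tgt nu ->
    comp la (comp mu nu) = comp (comp la mu) nu
}.

Notation degree k := {ffun 'I_k -> nat}.

Record kgraph (k : nat) := KGraph {
  gcat :> category;
  gcat_inhabited : inhabited (obj gcat);
  deg : gcat -> degree k;
  deg_ident : forall v, deg (ident v) = 0;
  deg_comp : forall mu nu, src mu = tgt nu -> deg (comp mu nu) = deg mu + deg nu;
  factorisation : forall la (m n : degree k), deg la = m + n ->
    exists! p : gcat * gcat,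
      [/\ deg p.1 = m, deg p.2 = n, src p.1 = tgt p.2 & la = comp p.1 p.2]
}.

Section Subquotient.
Variables (V : zmodType) (Z B : zmodClosed V).

Record subgrp := Subgrp { subgrp_val : V; _ : subgrp_val \in Z }.
HB.instance Definition _ := [isSub for subgrp_val].
HB.instance Definition _ := [Choice of subgrp by <:].
HB.instance Definition _ := [SubChoice_isSubZmodule of subgrp by <:].

Definition subgrp_in : {pred subgrp} := [pred x | val x \in B].
Fact subgrp_in_closed : zmod_closed subgrp_in.
Proof.
split=> [|x y]; rewrite !inE; first by rewrite raddf0 rpred0.
by move=> xB yB; rewrite raddfB rpredB.
Qed.
HB.instance Definition _ := GRing.isZmodClosed.Build subgrp subgrp_in
  subgrp_in_closed.

(* Z / (B cap Z), which is Z / B when B is contained in Z, as it is for cocycles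
   and coboundaries. *)
Definition subquotient : Type := Quotient.quot subgrp_in.
HB.instance Definition _ := GRing.Zmodule.on subquotient.

Definition class_of (x : subgrp) : subquotient :=
  (\pi_(Quotient.quot subgrp_in) x)%qT.
End Subquotient.

Section Cubical.
Variables (k : nat) (L : kgraph k).
Implicit Types (la : L) (i : 'I_k).

Definition gen i : degree k := [ffun j => (j == i) : nat].
Definition degB (m n : degree k) : degree k := [ffun j => (m j - n j)%N].

Definition is_cube r la :=
  [forall i, (deg la i <= 1)%N] && ((\sum_i deg la i)%N == r).
Definition cube (r : nat) := {la : L | is_cube r la}.

Definition factor la (m n : degree k) (h : deg la = m + n) : L * L :=
  sval (cid (factorisation h)).

Lemma factorP la m n (h : deg la = m + n) (p := factor h) :
  [/\ deg p.1 = m, deg p.2 = n, src p.1 = tgt p.2 & la = comp p.1 p.2].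
Proof. by case: (svalP (cid (factorisation h))). Qed.

Lemma deg_eq0 la : deg la = 0 <-> la = ident (src la).
Proof.
split=> [d0|->]; last exact: deg_ident.
have h : deg la = 0 + 0 by rewrite addr0.
have [p [_ u]] := factorisation h.
have h1 : p = (la, ident (src la)).
  by apply: u; rewrite /= deg_ident tgt_ident compm1; split.
have h2 : p = (ident (tgt la), la).
  by apply: u; rewrite /= deg_ident src_ident comp1m; split.
by move: h2; rewrite h1 => -[].
Qed.

Lemma card_dirs r (la : cube r) : #|[pred i | deg (val la) i == 1%N]| = r.
Proof.
case: la => la /= /andP[/forallP le1 /eqP <-]; rewrite -sum1_card big_mkcond.
by apply: eq_bigr => i _; move: (le1 i); rewrite !inE; case: (deg la i) => [|[]].
Qed.

(* [enum_val] enumerates in increasing order. *)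
Definition dir r (la : cube r) (j : 'I_r) : 'I_k :=
  enum_val (cast_ord (esym (card_dirs la)) j).

Lemma deg_dir r (la : cube r) j : deg (val la) (dir la j) = 1%N.
Proof. by have := enum_valP (cast_ord (esym (card_dirs la)) j) => /eqP. Qed.

Lemma deg_split la i : deg la i = 1%N ->
  deg la = degB (deg la) (gen i) + gen i.
Proof.
move=> h; apply/ffunP=> j; rewrite !ffunE; case: eqP => [->|_] /=.
  by rewrite h.
by rewrite subn0 addr0.
Qed.

Lemma deg_split' la i : deg la i = 1%N ->
  deg la = gen i + degB (deg la) (gen i).
Proof. by move=> /deg_split {1}->; rewrite addrC. Qed.

Definition face_mor r (l : bool) (j : 'I_r) (la : cube r) : L :=
  if l then (factor (deg_split' (deg_dir la j))).2
  else (factor (deg_split (deg_dir la j))).1.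

Lemma deg_face r l j (la : cube r) :
  deg (face_mor l j la) = degB (deg (val la)) (gen (dir la j)).
Proof.
case: l; first by case: (factorP (deg_split' (deg_dir la j))).
by case: (factorP (deg_split (deg_dir la j))).
Qed.

Fact face_subproof r l j (la : cube r.+1) : is_cube r (face_mor l j la).
Proof.
have dj := deg_dir la j; rewrite /is_cube deg_face.
case/andP: (valP la) => /forallP; move: dj.
move: (dir la j) (deg (val la)) => i m mi le1 /eqP sz; apply/andP; split.
  apply/forallP=> a; rewrite ffunE; exact: leq_trans (leq_subr _ _) (le1 a).
rewrite -eqSS -sz (bigD1 i) //= [X in _ == X](bigD1 i) //= !ffunE eqxx mi /=.
rewrite add0n add1n eqSS; apply/eqP/eq_bigr => a /negbTE ne.
by rewrite !ffunE ne subn0.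
Qed.

(* [face false j] and [face true j] are the faces F_{j+1}^0 and F_{j+1}^1. *)
Definition face r (l : bool) (j : 'I_r.+1) (la : cube r.+1) : cube r :=
  Sub (face_mor l j la) (face_subproof l j la).

Variable A : zmodType.

Definition cochain (r : nat) := cube r -> A.
HB.instance Definition _ r := GRing.Zmodule.on (cochain r).

(* The index i starts at 0, whence [i.+1] in the sign. *)
Definition cobound r (f : cochain r) : cochain r.+1 := fun la : cube r.+1 =>
  \sum_(i < r.+1) \sum_(l : bool) f (face l i la) *~ (-1) ^+ (i.+1 + l).

Fact coboundB r : {morph @cobound r : f g / f - g}.
Proof.
move=> f g; apply/funext=> la; rewrite /cobound !fctE -sumrB.
by apply: eq_bigr => i _; rewrite -sumrB; apply: eq_bigr => l _; rewrite mulrzBl.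
Qed.

Fact cobound0 r : cobound (0 : cochain r) = 0.
Proof. by rewrite -[X in cobound X](subrr 0) coboundB subrr. Qed.

Definition cocycle r : {pred cochain r} := [pred f | cobound f == 0].
Fact cocycle_closed r : zmod_closed (@cocycle r).
Proof.
split=> [|f g]; rewrite !inE ?cobound0 // coboundB => -> ->.
by rewrite subrr.
Qed.
HB.instance Definition _ r := GRing.isZmodClosed.Build (cochain r) (@cocycle r)
  (@cocycle_closed r).

Definition coboundary r : {pred cochain r} :=
  match r with
  | 0 => [pred f | f == 0]
  | r'.+1 => [pred f | `[< exists g : cochain r', f = cobound g >]]
  end.
Fact coboundary_closed r : zmod_closed (@coboundary r).
Proof.
case: r => [|r]; split=> [|f g]; rewrite !inE //.
- by move=> -> ->; rewrite subrr.
- by exists 0; rewrite cobound0.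
- move=> [f' ->] [g' ->]; by exists (f' - g'); rewrite coboundB.
Qed.
HB.instance Definition _ r := GRing.isZmodClosed.Build (cochain r)
  (@coboundary r) (@coboundary_closed r).

Definition cohomology r := subquotient (@cocycle r) (@coboundary r).
HB.instance Definition _ r := GRing.Zmodule.on (cohomology r).
Definition coh_class r (f : subgrp (@cocycle r)) : cohomology r := class_of _ f.

End Cubical.

Section Categorical.
Variables (k : nat) (L : kgraph k).

Definition composable r (t : r.-tuple L) :=
  [forall i : 'I_r, forall j : 'I_r,
    (j == i.+1 :> nat) ==> (src (tnth t i) == tgt (tnth t j))].

(* The elements of degree 0 are the identities (deg_eq0), here represented by
   the objects. *)
Definition chain (r : nat) : Type :=
  match r with
  | 0 => obj L
  | r'.+1 => {t : r'.+1.-tuple L | composable t}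
  end.

Fact composable1 (la : L) : composable [tuple la].
Proof. by apply/forallP=> i; apply/forallP=> j; rewrite !ord1. Qed.

Definition chain1 (la : L) : chain 1 := Sub [tuple la] (composable1 la).

Definition wid n (j : 'I_n) : 'I_n.+1 := widen_ord (leqnSn n) j.

Definition drop_first n (t : n.+2.-tuple L) : n.+1.-tuple L :=
  [tuple tnth t (lift ord0 j) | j < n.+1].
Definition drop_last n (t : n.+2.-tuple L) : n.+1.-tuple L :=
  [tuple tnth t (wid j) | j < n.+1].
(* The entries of index i and i + 1 (counting from 0) are composed. *)
Definition merge_at n (i : 'I_n.+1) (t : n.+2.-tuple L) : n.+1.-tuple L :=
  [tuple if (j < i)%N then tnth t (wid j)
         else if j == i then comp (tnth t (wid j)) (tnth t (lift ord0 j))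
         else tnth t (lift ord0 j) | j < n.+1].

Lemma composableP n (t : n.-tuple L) : reflect
  (forall i j : 'I_n, j = i.+1 :> nat -> src (tnth t i) = tgt (tnth t j))
  (composable t).
Proof.
apply: (iffP forallP) => [h i j e|h i].
  by apply/eqP; move/forallP: (h i) => /(_ j); rewrite e eqxx.
by apply/forallP=> j; apply/implyP=> /eqP e; apply/eqP/h.
Qed.

Fact drop_first_composable n (t : n.+2.-tuple L) :
  composable t -> composable (drop_first t).
Proof.
move=> /composableP h; apply/composableP=> i j e; rewrite !tnth_mktuple.
by apply: h; rewrite /= /bump /= e.
Qed.
Fact drop_last_composable n (t : n.+2.-tuple L) :
  composable t -> composable (drop_last t).
Proof.
by move=> /composableP h; apply/composableP=> i j e; rewrite !tnth_mktuple; apply: h.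
Qed.
Fact merge_at_composable n (i : 'I_n.+1) (t : n.+2.-tuple L) :
  composable t -> composable (merge_at i t).
Proof.
move=> /composableP h; apply/composableP=> a b e; rewrite !tnth_mktuple.
have wl (c : 'I_n.+1) : src (tnth t (wid c)) = tgt (tnth t (lift ord0 c)).
  exact: h.
have -> : src (if (a < i)%N then tnth t (wid a)
         else if a == i then comp (tnth t (wid a)) (tnth t (lift ord0 a))
         else tnth t (lift ord0 a)) =
  src (if (a < i)%N then tnth t (wid a) else tnth t (lift ord0 a)).
  by case: ifP => // _; case: ifP => // _; rewrite src_comp.
have -> : tgt (if (b < i)%N then tnth t (wid b)
         else if b == i then comp (tnth t (wid b)) (tnth t (lift ord0 b))
         else tnth t (lift ord0 b)) =
  tgt (if (b <= i)%N then tnth t (wid b) else tnth t (lift ord0 b)).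
  rewrite [(b <= i)%N]leq_eqVlt -[b == i :> nat]/(b == i).
  by case: ltnP; rewrite ?orbT // orbF => _; case: ifP => // _; rewrite tgt_comp.
by rewrite e; case: ifP => lt; apply: h; rewrite /= /bump /= e.
Qed.

Definition chain_first n (t : chain n.+2) : chain n.+1 :=
  Sub (drop_first (val t)) (drop_first_composable (valP t)).
Definition chain_last n (t : chain n.+2) : chain n.+1 :=
  Sub (drop_last (val t)) (drop_last_composable (valP t)).
Definition chain_merge n (i : 'I_n.+1) (t : chain n.+2) : chain n.+1 :=
  Sub (merge_at i (val t)) (merge_at_composable i (valP t)).

Variable A : zmodType.

Definition cat_fun (r : nat) := chain r -> A.
HB.instance Definition _ r := GRing.Zmodule.on (cat_fun r).

Definition cat_cochain r : {pred cat_fun r} :=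
  match r with
  | 0 => predT
  | r'.+1 => [pred f : cat_fun r'.+1 | `[< forall t : chain r'.+1,
      (exists i, deg (tnth (val t) i) = 0) -> f t = 0 >]]
  end.
Fact cat_cochain_closed r : zmod_closed (@cat_cochain r).
Proof.
case: r => [|r]; split=> // [|f g]; rewrite !inE // => hf hg t ht.
by rewrite !fctE hf // hg // subrr.
Qed.
HB.instance Definition _ r := GRing.isZmodClosed.Build (cat_fun r)
  (@cat_cochain r) (@cat_cochain_closed r).

(* For [r = n.+1] the composed entries are those of index i and i + 1 with i
   starting at 0, whence [i.+1] in the sign. *)
Definition cat_cobound r : cat_fun r -> cat_fun r.+1 :=
  match r with
  | 0 => fun f t =>
      let la := tnth (val t) ord0 in f (src la) - f (tgt la)
  | n.+1 => fun f t =>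
      f (chain_first t) + \sum_(i < n.+1) f (chain_merge i t) *~ (-1) ^+ i.+1
      + f (chain_last t) *~ (-1) ^+ n.+2
  end.

Fact cat_coboundB r : {morph @cat_cobound r : f g / f - g}.
Proof.
case: r => [|r] f g; apply/funext=> t /=; rewrite !fctE.
  by rewrite !opprD !opprK addrACA.
rewrite mulrzBl; under eq_bigr do rewrite mulrzBl; rewrite sumrB.
by rewrite !opprD [RHS]addrACA; congr (_ + _); rewrite [RHS]addrACA.
Qed.

Fact cat_cobound0 r : cat_cobound (0 : cat_fun r) = 0.
Proof. by rewrite -[X in cat_cobound X](subrr 0) cat_coboundB subrr. Qed.

Definition cat_cocycle r : {pred cat_fun r} :=
  [pred f | (f \in @cat_cochain r) && (cat_cobound f == 0)].
Fact cat_cocycle_closed r : zmod_closed (@cat_cocycle r).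
Proof.
split=> [|f g]; rewrite !inE.
  by rewrite rpred0 cat_cobound0 eqxx.
move=> /andP[nf /eqP zf] /andP[ng /eqP zg].
by rewrite rpredB // cat_coboundB zf zg subrr eqxx.
Qed.
HB.instance Definition _ r := GRing.isZmodClosed.Build (cat_fun r)
  (@cat_cocycle r) (@cat_cocycle_closed r).

Definition cat_coboundary r : {pred cat_fun r} :=
  match r with
  | 0 => [pred f | f == 0]
  | r'.+1 => [pred f | `[< exists2 g : cat_fun r',
                            g \in @cat_cochain r' & f = cat_cobound g >]]
  end.
Fact cat_coboundary_closed r : zmod_closed (@cat_coboundary r).
Proof.
case: r => [|r]; split=> [|f g]; rewrite !inE //.
- by move=> -> ->; rewrite subrr.
- by exists 0; rewrite ?rpred0 ?cat_cobound0.
- move=> [f' nf ->] [g' ng ->].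
  by exists (f' - g'); rewrite ?rpredB // cat_coboundB.
Qed.
HB.instance Definition _ r := GRing.isZmodClosed.Build (cat_fun r)
  (@cat_coboundary r) (@cat_coboundary_closed r).

Definition cat_cohomology r := subquotient (@cat_cocycle r) (@cat_coboundary r).
HB.instance Definition _ r := GRing.Zmodule.on (cat_cohomology r).
Definition cat_coh_class r (f : subgrp (@cat_cocycle r)) : cat_cohomology r :=
  class_of _ f.

Definition restrict1 (g : cat_fun 1) : cochain L A 1 :=
  fun la : cube L 1 => g (chain1 (val la)).

End Categorical.

Arguments cocycle {k L A} r.
Arguments coboundary {k L A} r.
Arguments cat_cocycle {k L A} r.
Arguments cat_coboundary {k L A} r.

(* Main.v *)
From HB Require Import structures.
Require Import Defs.
From mathcomp Require Import all_boot all_order all_algebra.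
From mathcomp Require Import all_classical.

(** A categorical 1-cocycle is the same thing as a functor from the category
to the group A, that is, a map that turns composites into sums
([cat_cocycle1P]), and a cubical 1-cocycle is a function on edges which, on
every 2-cube, has the same sum along the two edge paths from range to source
([cocycle1P]).  Since every morphism is a composite of edges, a functor is
determined by its values on edges ([eq_composition_additive]); since a 2-cube
is the composite of either of its two edge paths ([square_faces]), these values
form a cubical cocycle.

Conversely, given a cubical cocycle, the value of its extension at a morphism
is the sum of the values on the edges of a factorisation into edges.  The point
is that the sum is independent of the factorisation: two factorisations which
begin with edges of different directions i and j can both be rewritten, by the
factorisation property, to begin with the two edge paths of a common 2-cube and
to agree after it, so that induction on the length and the square relation
finish the proof ([path_sum_edge]).

Restriction to edges sends the coboundary of a function on objects to the
cubical coboundary of the same function, so, by uniqueness of extensions, it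
matches coboundaries with coboundaries ([restrict1_coboundary]).  The
isomorphism of cohomology groups is then the formal fact that a homomorphism
which maps cocycles onto cocycles and both preserves and reflects coboundaries
induces an isomorphism of quotients ([subquotient_iso]); the map of the theorem
is the inverse of the one induced by restriction. *)

Import GRing.Theory.
Local Open Scope ring_scope.

Set Implicit Arguments.
Unset Strict Implicit.

(* [comp] otherwise denotes composition of functions. *)
Local Notation comp := Defs.comp.

(** * Isomorphisms of subquotients *)

Section Subquotients.
Variables (V : zmodType) (Z B : zmodClosed V).

Lemma class_ofB (x y : subgrp Z) : class_of B (x - y) = class_of B x - class_of B y.
Proof. exact: raddfB. Qed.

Lemma class_of_repr (x : subquotient Z B) : class_of B (repr x) = x.
Proof. exact: reprK. Qed.

Lemma class_of_surj (x : subquotient Z B) : exists f, x = class_of B f.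
Proof. by exists (repr x); rewrite class_of_repr. Qed.

Lemma class_ofP (x y : subgrp Z) :
  class_of B x = class_of B y <-> val x - val y \in B.
Proof.
rewrite -raddfB; split=> [/eqP|h].
  by rewrite -Quotient.idealrBE.
by apply/eqP; rewrite -Quotient.idealrBE.
Qed.

End Subquotients.

(** The isomorphism goes against the direction of [R]: it sends the class of an
element to the class of any of its lifts along [R].  The class does not depend
on the lift, because two lifts of one element differ by something that [R] sends
to [0], hence into [B]. *)
Lemma subquotient_iso (V W : zmodType) (Z B : zmodClosed V) (Z' B' : zmodClosed W)
    (R : W -> V) :
    {morph R : x y / x - y} ->
    (forall g, g \in Z' -> R g \in Z) ->
    (forall f, f \in Z -> exists2 g, g \in Z' & R g = f) ->
    (forall g, g \in Z' -> R g \in B <-> g \in B') ->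
  exists phi : {additive subquotient Z B -> subquotient Z' B'},
    bijective phi /\
    forall (f : subgrp Z) (g : subgrp Z'),
      R (val g) = val f -> phi (class_of B f) = class_of B' g.
Proof.
move=> RB RZ Rsurj RBE.
have liftP (f : subgrp Z) : exists g : subgrp Z', R (val g) = val f.
  by have [g gZ gf] := Rsurj _ (valP f); exists (Subgrp gZ).
pose lift f := sval (cid (liftP f)).
have liftE f : R (val (lift f)) = val f := svalP (cid (liftP f)).
pose res (g : subgrp Z') : subgrp Z := Subgrp (RZ _ (valP g)).
have resE g : val (res g) = R (val g) by [].
pose phi (x : subquotient Z B) : subquotient Z' B' := class_of B' (lift (repr x)).
pose psi (y : subquotient Z' B') : subquotient Z B := class_of B (res (repr y)).
have phiE (f : subgrp Z) (g : subgrp Z') :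
    R (val g) = val f -> phi (class_of B f) = class_of B' g.
  move=> gf; apply/class_ofP/RBE; first by apply: rpredB; apply: valP.
  by rewrite RB liftE gf; apply/class_ofP; rewrite class_of_repr.
have psiE g : psi (class_of B' g) = class_of B (res g).
  apply/class_ofP; rewrite !resE -RB; apply/RBE; first by apply: rpredB; apply: valP.
  by apply/class_ofP; rewrite class_of_repr.
have phiB : zmod_morphism phi.
  move=> x y; have [f ->] := class_of_surj x; have [f' ->] := class_of_surj y.
  rewrite (phiE _ _ (liftE f)) (phiE _ _ (liftE f')) -!class_ofB.
  by apply: phiE; rewrite !raddfB RB !liftE.
pose phiA := GRing.isZmodMorphism.Build _ _ phi phiB.
pose Phi : {additive subquotient Z B -> subquotient Z' B'} := HB.pack phi phiA.
exists Phi; split=> //; exists psi => [x|y] /=.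
  have [f ->] := class_of_surj x.
  rewrite (phiE _ _ (liftE f)) psiE; congr class_of.
  by apply: val_inj; rewrite resE liftE.
by have [g ->] := class_of_surj y; rewrite psiE; apply: phiE; rewrite resE.
Qed.

(** * Factorisation of morphisms into edges *)

Section Factorisation.
Variables (k : nat) (L : kgraph k).
Implicit Types (la mu nu e : L) (i j : 'I_k) (m n : degree k).

Lemma degree_addI m : injective (+%R m).
Proof.
by move=> n p /ffunP h; apply/ffunP=> i; move: (h i); rewrite !ffunE => /addnI.
Qed.

(** Only the degrees of the left factors are compared: those of the right
factors then agree because degrees can be cancelled. *)
Lemma factorisation_uniq mu nu mu' nu' :
    src mu = tgt nu -> src mu' = tgt nu' -> comp mu nu = comp mu' nu' ->
    deg mu = deg mu' -> mu = mu' /\ nu = nu'.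
Proof.
move=> c c' E d.
have d2 : deg nu' = deg nu.
  by apply: (@degree_addI (deg mu)); rewrite {1}d -!deg_comp // E.
have [p [_ u]] := factorisation (deg_comp c).
have h1 : p = (mu, nu) by apply: u.
have h2 : p = (mu', nu') by apply: u.
by move: h2; rewrite h1 => -[].
Qed.

Lemma first_edge_factor la i : deg la i != 0%N ->
  exists p : L * L, [/\ deg p.1 = gen i, src p.1 = tgt p.2 & la = comp p.1 p.2].
Proof.
move=> di; have h : deg la = gen i + degB (deg la) (gen i).
  apply/ffunP=> j; rewrite !ffunE; case: eqP => [->|_]; last by rewrite subn0 add0r.
  by rewrite -[RHS]/(1 + (deg la i - 1))%N subnKC ?lt0n.
have [p [[d1 d2 c E] _]] := factorisation h.
by exists p.
Qed.

Definition len la := (\sum_i deg la i)%N.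

Lemma len_comp mu nu : src mu = tgt nu -> len (comp mu nu) = (len mu + len nu)%N.
Proof.
by move=> c; rewrite /len -big_split deg_comp //; apply: eq_bigr => i _; rewrite ffunE.
Qed.

Lemma sum_gen i : (\sum_j gen i j)%N = 1%N.
Proof.
rewrite (bigD1 i) //= ffunE eqxx big1 // => j /negbTE ne.
by rewrite ffunE ne.
Qed.

Lemma len_edge e i : deg e = gen i -> len e = 1%N.
Proof. by rewrite /len => ->; apply: sum_gen. Qed.

Lemma deg_neq0 la : len la != 0%N -> exists i, deg la i != 0%N.
Proof.
move=> l; apply/existsP; apply: contra_neqT l => /existsPn h.
by apply: big1 => i _; apply/eqP; move: (h i); rewrite negbK.
Qed.

(** Edges are peeled off on the left; a morphism of length 0 has degree 0 and
is therefore an identity. *)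
Lemma edge_ind (P : L -> Prop) :
    (forall v, P (ident v)) ->
    (forall i e mu, deg e = gen i -> src e = tgt mu -> P mu -> P (comp e mu)) ->
  forall la, P la.
Proof.
move=> Pid Pcomp la; have [n] := ubnP (len la).
elim: n la => // n IH la /ltnSE lan.
have [l0|/deg_neq0 [i /first_edge_factor[[e mu] /= [de c E]]]] := eqVneq (len la) 0%N.
  suff -> : la = ident (src la) by [].
  apply/deg_eq0/ffunP=> i; rewrite ffunE.
  by move/eqP: l0; rewrite /len sum_nat_eq0 => /forallP /(_ i) /eqP.
rewrite E; apply: (Pcomp i) => //; apply: IH; apply: leq_trans lan.
by rewrite E len_comp // (len_edge de).
Qed.

End Factorisation.

(** * Faces of cubes of dimension 1 and 2 *)

Section Cubes.
Variables (k : nat) (L : kgraph k).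
Implicit Types (e : L) (i : 'I_k).

Lemma deg_cube r (la : cube L r) : deg (val la) = \sum_(j < r) gen (dir la j).
Proof.
pose D := [pred i | deg (val la) i == 1%N].
have -> : \sum_(j < r) gen (dir la j) = \sum_(i in D) gen i :> degree k.
  rewrite -[LHS]/(\sum_(j < r) gen (enum_val (cast_ord (esym (card_dirs la)) j))).
  rewrite [RHS]big_enum_val [RHS](reindex (cast_ord (esym (card_dirs la)))) //=.
  by exists (cast_ord (card_dirs la)) => j _; rewrite ?cast_ordK ?cast_ordKV.
apply/ffunP=> i; rewrite sum_ffunE.
have := forallP (proj1 (andP (valP la))) i.
have [di _|ne le1] := eqVneq (deg (val la) i) 1%N.
  rewrite di (bigD1 i) ?inE ?di //= ffunE eqxx big1 ?addr0 // => j /andP[_ ne].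
  by rewrite ffunE eq_sym (negbTE ne).
rewrite big1 => [|j]; first by case: (deg (val la) i) ne le1 => [|[]].
by rewrite inE ffunE => /eqP dj; case: eqP => // ij; case/eqP: ne; rewrite ij.
Qed.

Lemma deg_edge (e : cube L 1) : deg (val e) = gen (dir e ord0).
Proof. by rewrite deg_cube big_ord1. Qed.

Lemma is_cube_edge e i : deg e = gen i -> is_cube 1 e.
Proof.
move=> de; rewrite /is_cube de sum_gen eqxx andbT.
by apply/forallP=> j; rewrite ffunE; case: eqP.
Qed.

Lemma is_cube_square la i j : i != j -> deg la = gen i + gen j -> is_cube 2 (la : L).
Proof.
move=> ne dla; rewrite /is_cube dla; apply/andP; split.
  apply/forallP=> a; rewrite !ffunE.
  by have [->|_] := eqVneq a i; rewrite ?(negbTE ne) //; case: eqP.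
by apply/eqP; under eq_bigr do rewrite ffunE; rewrite big_split /= !sum_gen.
Qed.

Lemma is_cube_ident v : is_cube 0 (ident v : L).
Proof.
rewrite /is_cube deg_ident big1 => [|i _]; last by rewrite ffunE.
by rewrite eqxx andbT; apply/forallP=> i; rewrite ffunE.
Qed.

Definition cube_ident v : cube L 0 := Sub (ident v) (is_cube_ident v).

Lemma cube0E (v : cube L 0) : v = cube_ident (src (val v)).
Proof.
by apply: val_inj; apply/deg_eq0; rewrite deg_cube big_ord0.
Qed.

Lemma face0P r j (la : cube L r.+1) : exists b : L,
  [/\ deg b = gen (dir la j), src (val (face false j la)) = tgt b
    & val la = comp (val (face false j la)) b].
Proof.
rewrite SubK /face_mor; case: (factorP (deg_split (deg_dir la j))) => _ d2 c E.
by exists (Defs.factor (deg_split (deg_dir la j))).2.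
Qed.

Lemma face1P r j (la : cube L r.+1) : exists a : L,
  [/\ deg a = gen (dir la j), src a = tgt (val (face true j la))
    & val la = comp a (val (face true j la))].
Proof.
rewrite SubK /face_mor; case: (factorP (deg_split' (deg_dir la j))) => d1 _ c E.
by exists (Defs.factor (deg_split' (deg_dir la j))).1.
Qed.

Lemma face_edge (e : cube L 1) :
  face false ord0 e = cube_ident (tgt (val e)) /\
  face true ord0 e = cube_ident (src (val e)).
Proof.
have [b [_ c0 E0]] := face0P ord0 e; have [a [_ c1 E1]] := face1P ord0 e.
have id0 (v : cube L 0) : val v = ident (src (val v)).
  by rewrite {1}[v]cube0E.
split; rewrite [LHS]cube0E; congr cube_ident.
  by rewrite E0 tgt_comp // [in RHS]id0 tgt_ident.
by rewrite E1 src_comp.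
Qed.

(** Removing direction [a] at the end of a square leaves an edge of direction
[b], which is also what remains when the opposite face, in direction [b], is
removed at the start: both give the factorisation of the square with left
factor of direction [b].  For the two choices of [a] these are the two edge paths of the
square. *)
Lemma square_faces (la : cube L 2) (a b : 'I_2) : a != b ->
  [/\ deg (val (face false a la)) = gen (dir la b),
      src (val (face false a la)) = tgt (val (face true b la))
    & val la = comp (val (face false a la)) (val (face true b la))].
Proof.
move=> ab; have [be [dbe c E]] := face0P a la; have [al [dal c' E']] := face1P b la.
have dF : deg (val (face false a la)) = gen (dir la b).
  have h : deg (val la) = gen (dir la a) + gen (dir la b).
    rewrite deg_cube (bigD1 a) //= (bigD1 b) 1?eq_sym //= big1 ?addr0 // => j.
    by case: a b j ab {be dbe c E al dal c' E'} => [[|[]] ?] // [[|[]] ?] // [[|[]] ?].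
  apply: (@degree_addI _ (gen (dir la a))); rewrite -h E deg_comp //.
  by rewrite dbe addrC.
have [Eal _] := factorisation_uniq c c' (etrans (esym E) E') (etrans dF (esym dal)).
by split; rewrite // Eal.
Qed.

End Cubes.

(** * Extension of a function on edges to a functor *)

Section Extension.
Variables (k : nat) (L : kgraph k) (A : zmodType).
Implicit Types (la mu nu e : L) (i j : 'I_k) (f h : L -> A).

Definition composition_additive h :=
  forall mu nu, src mu = tgt nu -> h (comp mu nu) = h mu + h nu.

Lemma composition_additive_ident h v : composition_additive h -> h (ident v) = 0.
Proof.
move=> hadd; have c : src (ident v : L) = tgt (ident v : L) by rewrite src_ident tgt_ident.
apply: (addrI (h (ident v))); rewrite -hadd // addr0; congr h.
by rewrite -{2}(src_ident (c:=L) v) compm1.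
Qed.

Lemma eq_composition_additive h h' :
    composition_additive h -> composition_additive h' ->
    (forall i e, deg e = gen i -> h e = h' e) ->
  h =1 h'.
Proof.
move=> hadd hadd' hE; apply: edge_ind => [v|i e mu de c IH].
  by rewrite !composition_additive_ident.
by rewrite hadd // hadd' // (hE i) // IH.
Qed.

(** The square [a b = b' a'] is given by its four edges rather than as a
2-cube, so that the directions [i] and [j] enter symmetrically and no order on
them has to be considered. *)
Definition square_additive f := forall i j a b b' a', i != j ->
  deg a = gen i -> deg b = gen j -> deg b' = gen j -> deg a' = gen i ->
  src a = tgt b -> src b' = tgt a' -> comp a b = comp b' a' ->
  f a + f b = f b' + f a'.

(** An arbitrary factorisation with an edge on the left; the default pair is
only reached at identities. *)
Definition peel la : L * L := xget (la, la)
  [set p | exists i, [/\ deg p.1 = gen i, src p.1 = tgt p.2 & la = comp p.1 p.2]]%classic.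

Lemma peelP la : len la != 0%N ->
  exists i, [/\ deg (peel la).1 = gen i, src (peel la).1 = tgt (peel la).2
              & la = comp (peel la).1 (peel la).2].
Proof.
move=> /deg_neq0 [i /first_edge_factor[p pP]].
by rewrite /peel; case: xgetP => [q _ //|/(_ p) []]; exists i.
Qed.

Fixpoint peel_sum f n la : A :=
  if n is n'.+1 then f (peel la).1 + peel_sum f n' (peel la).2 else 0.

Definition path_sum f la := peel_sum f (len la) la.

Lemma path_sum_ident f v : path_sum f (ident v) = 0.
Proof. by rewrite /path_sum /len deg_ident big1 // => i _; rewrite ffunE. Qed.

(** The value of [path_sum] can be computed by peeling off any left edge, not
just the one that [peel] chooses.  If [comp e mu = comp e1 mu1] with [e] and
[e1] of different directions [i] and [j], then [mu] begins with an edge [b] of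
direction [j], [mu1] with an edge [a'] of direction [i], and uniqueness of
factorisation forces [comp e b = comp e1 a'] with a common remainder [tau].
The induction hypothesis applies to [mu] and [mu1], and the square relation
compares the rest. *)
Lemma path_sum_edge f i e mu : square_additive f -> deg e = gen i ->
  src e = tgt mu -> path_sum f (comp e mu) = f e + path_sum f mu.
Proof.
move=> sq; have [n] := ubnP (len mu).
elim: n i e mu => // n IH i e mu /ltnSE mun de c.
have ln : len (comp e mu) = (len mu).+1 by rewrite len_comp // (len_edge de).
rewrite {1}/path_sum ln /=.
have [j []] : exists j, [/\ deg (peel (comp e mu)).1 = gen j,
    src (peel (comp e mu)).1 = tgt (peel (comp e mu)).2
  & comp e mu = comp (peel (comp e mu)).1 (peel (comp e mu)).2].
  by apply: peelP; rewrite ln.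
case: (peel _) => e1 mu1 /= de1 c1 E.
have ln1 : len mu1 = len mu.
  by apply/eqP; rewrite -eqSS -ln E len_comp // (len_edge de1).
rewrite -ln1 -/(path_sum f mu1).
have [ij|ne] := eqVneq i j.
  by have [-> ->] := factorisation_uniq c c1 E (etrans de (etrans (congr1 _ ij) (esym de1))).
have dE : gen i + deg mu = gen j + deg mu1 by rewrite -de -de1 -!deg_comp // E.
have dmu : deg mu j != 0%N.
  move/ffunP/(_ j): dE; rewrite !ffunE eqxx eq_sym (negbTE ne) => dj.
  by apply/eqP=> d0; rewrite d0 in dj.
have dmu1 : deg mu1 i != 0%N.
  move/ffunP/(_ i): dE; rewrite !ffunE eqxx (negbTE ne) => dj.
  by apply/eqP=> d0; rewrite d0 in dj.
have [[b tau] /= [db cb Emu]] := first_edge_factor dmu.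
have [[a' tau'] /= [da' ca' Emu1]] := first_edge_factor dmu1.
have ceb : src e = tgt b by rewrite c Emu tgt_comp.
have cea : src e1 = tgt a' by rewrite c1 Emu1 tgt_comp.
have [Esq Etau] : comp e b = comp e1 a' /\ tau = tau'.
  apply: factorisation_uniq; rewrite ?src_comp // -?Defs.compA //.
    by move: E; rewrite Emu Emu1 !Defs.compA.
  by rewrite !deg_comp // de db de1 da' addrC.
have lt : (len tau < n)%N by apply: leq_trans mun; rewrite Emu len_comp // (len_edge db).
rewrite Emu Emu1 (IH j b tau) // (IH i a' tau') -?Etau // ?Etau //.
by rewrite !addrA (sq i j e b e1 a').
Qed.

Lemma path_sum_additive f : square_additive f -> composition_additive (path_sum f).
Proof.
move=> sq mu nu; move: mu; apply: edge_ind => [v|i e mu de c IH] c'.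
  by rewrite path_sum_ident add0r; rewrite src_ident in c'; rewrite c' comp1m.
rewrite src_comp // in c'.
by rewrite -Defs.compA // !(path_sum_edge sq de) ?tgt_comp // IH // addrA.
Qed.

Lemma path_sum_on_edge f i e : square_additive f -> deg e = gen i -> path_sum f e = f e.
Proof.
move=> sq de; rewrite -{1}[e]compm1 (path_sum_edge sq de) ?tgt_ident //.
by rewrite path_sum_ident addr0.
Qed.

End Extension.

(** * Comparison of the two complexes in degree 1 *)

Section Comparison.
Variables (k : nat) (L : kgraph k) (A : zmodType).
Implicit Types (f : cochain L A 1) (g : cat_fun L A 1).

Lemma chain1K (t : chain L 1) : chain1 (tnth (val t) ord0) = t.
Proof.
by apply: val_inj; apply: eq_from_tnth => i; rewrite (ord1 i).
Qed.

(** Normalisation comes for free: a map that turns composites into sums vanishes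
on identities. *)
Lemma cat_cocycle1P g :
  g \in cat_cocycle 1 <-> composition_additive (fun la => g (chain1 la)).
Proof.
have cobE (t : chain L 2) : cat_cobound g t =
    g (chain1 (tnth (val t) (lift ord0 ord0)))
    - g (chain1 (comp (tnth (val t) ord0) (tnth (val t) (lift ord0 ord0))))
    + g (chain1 (tnth (val t) ord0)).
  rewrite /= big_ord1 -[chain_first t]chain1K -[chain_merge _ t]chain1K.
  rewrite -[chain_last t]chain1K !SubK !tnth_mktuple /=.
  have -> : wid (ord0 : 'I_1) = ord0 by apply: val_inj.
  by rewrite expr1 mulrN1z sqrrN expr1n mulr1z.
rewrite inE; split=> [/andP[_ /eqP g0] mu nu c | gadd].
  have cc : composable [tuple mu; nu].
    by apply/composableP=> -[[|[]] ?] // -[[|[]] ?].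
  have /eqP := congr1 (fun u => u (Sub [tuple mu; nu] cc)) g0.
  rewrite cobE SubK !(tnth_nth mu) /= addrAC subr_eq0 => /eqP <-.
  by rewrite addrC.
apply/andP; split.
  apply/asboolP=> t [i]; rewrite ord1 => /deg_eq0 E.
  by rewrite -[t]chain1K E; apply: (composition_additive_ident _ gadd).
apply/eqP/funext=> t; rewrite cobE (gadd (tnth _ ord0)).
  by rewrite addrAC [X in X - _]addrC subrr.
by apply: (composableP _ (valP t)).
Qed.

(** Both sides are sums along an edge path of the square, see
[square_faces]. *)
Lemma cocycle1P f : f \in cocycle 1 <-> forall la : cube L 2,
  f (face false ord_max la) + f (face true ord0 la) =
  f (face false ord0 la) + f (face true ord_max la).
Proof.
have cobE la : cobound f la =
    f (face false ord_max la) + f (face true ord0 la)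
    - (f (face false ord0 la) + f (face true ord_max la)).
  rewrite /cobound big_ord_recl big_ord1 !big_bool /=.
  have -> : lift ord0 ord0 = ord_max :> 'I_2 by apply: val_inj.
  rewrite /bump /= !addn0 !exprS !expr0 !mulr1 !mulrNN !mulr1 !mulrN1z !mulr1z.
  by rewrite opprD [X in X + (_ - _)]addrC [X in _ + X = _]addrC addrACA.
rewrite inE; split=> [f0 la | fE].
  by apply/eqP; rewrite -subr_eq0 -cobE f0.
by apply/funext=> la; rewrite cobE fE subrr.
Qed.

(** Extension by the junk value [0] outside edges, which lets cubical cochains
be fed to [path_sum]. *)
Definition edge_fun f (e : L) : A := oapp f 0 (insub e : option (cube L 1)).

Lemma edge_funE f (e : cube L 1) : edge_fun f (val e) = f e.
Proof. by rewrite /edge_fun valK. Qed.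

(** The directions of the 2-cube [comp a b] are enumerated as [i, j] or as
[j, i], depending on which is smaller; in either case uniqueness of factorisation
identifies the two paths [a, b] and [b', a'] with those of [square_faces], and
the cocycle relation is symmetric in them. *)
Lemma square_additive_edge_fun f : f \in cocycle 1 -> square_additive (edge_fun f).
Proof.
move=> /cocycle1P fE i j a b b' a' ne da db db' da' c c' E.
pose sq : cube L 2 := Sub (comp a b) (is_cube_square ne (etrans (deg_comp c) (congr2 _ da db))).
have [d0 c0 E0] := @square_faces _ _ sq ord0 ord_max isT.
have [d1 c1 E1] := @square_faces _ _ sq ord_max ord0 isT.
have {fE} := fE sq; rewrite -!edge_funE.
have dsq : gen i + gen j = gen (dir sq ord0) + gen (dir sq ord_max).
  rewrite -da -db -deg_comp // -[comp a b]/(val sq) deg_cube big_ord_recl big_ord1.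
  by congr (_ + gen (dir _ _)); apply: val_inj.
have E' : comp b' a' = val sq by [].
(* Comparing degrees at [i] shows that [i] is one of the two directions. *)
have [ip|ne'] := eqVneq i (dir sq ord0).
  have jq : gen j = gen (dir sq ord_max).
    by apply: (@degree_addI _ (gen i)); rewrite dsq ip.
  have [-> ->] := factorisation_uniq c c1 E1 (etrans da (etrans (congr1 _ ip) (esym d1))).
  by have [-> ->] := factorisation_uniq c' c0 (etrans E' E0) (etrans db' (etrans jq (esym d0))).
have iq : i = dir sq ord_max.
  move/ffunP/(_ i): dsq; rewrite !ffunE eqxx (negbTE ne') (negbTE ne).
  by case: eqP.
have jp : gen j = gen (dir sq ord0).
  by apply: (@degree_addI _ (gen i)); rewrite dsq {1}iq addrC.
have [-> ->] := factorisation_uniq c c0 E0 (etrans da (etrans (congr1 _ iq) (esym d0))).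
by have [-> ->] := factorisation_uniq c' c1 (etrans E' E1) (etrans db' (etrans jp (esym d1))).
Qed.

Lemma restrict1_cocycle g : g \in cat_cocycle 1 -> restrict1 g \in cocycle 1.
Proof.
move=> /cat_cocycle1P gadd; apply/cocycle1P=> la.
have [_ c0 E0] := @square_faces _ _ la ord0 ord_max isT.
have [_ c1 E1] := @square_faces _ _ la ord_max ord0 isT.
by rewrite /restrict1 -!gadd // -E0 -E1.
Qed.

Lemma restrict1_cocycle_inj g g' : g \in cat_cocycle 1 -> g' \in cat_cocycle 1 ->
  restrict1 g = restrict1 g' -> g = g'.
Proof.
move=> /cat_cocycle1P gadd /cat_cocycle1P gadd' E; apply/funext=> t.
rewrite -[t]chain1K; apply: (eq_composition_additive gadd gadd') => i e de.
exact: (congr1 (fun u => u (Sub e (is_cube_edge de))) E).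
Qed.

Lemma restrict1_surj f : f \in cocycle 1 ->
  exists2 g, g \in cat_cocycle 1 & restrict1 g = f.
Proof.
move=> /square_additive_edge_fun sq.
exists (fun t : chain L 1 => path_sum (edge_fun f) (tnth (val t) ord0)).
  by apply/cat_cocycle1P; apply: path_sum_additive.
apply/funext=> e; rewrite -[RHS]edge_funE.
exact: path_sum_on_edge sq (deg_edge e).
Qed.

Lemma restrict1_cobound (u : cat_fun L A 0) :
  restrict1 (cat_cobound u) = cobound (fun v : cube L 0 => u (src (val v))).
Proof.
apply/funext=> e; rewrite /cobound big_ord1 big_bool (face_edge e).1 (face_edge e).2.
by rewrite /restrict1 /= !src_ident sqrrN expr1n mulr1z expr1 mulrN1z.
Qed.

Lemma cat_cobound_cocycle (u : cat_fun L A 0) : cat_cobound u \in cat_cocycle 1.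
Proof.
apply/cat_cocycle1P=> mu nu c /=.
rewrite ![tnth _ _]/= src_comp // tgt_comp // c.
by rewrite [RHS]addrC addrA subrK.
Qed.

(** If the restriction of [g] is the coboundary of [w], then [g] and the
categorical coboundary of [w], read as a function on objects, are two cocycles
with the same restriction, hence equal. *)
Lemma restrict1_coboundary g : g \in cat_cocycle 1 ->
  restrict1 g \in coboundary 1 <-> g \in cat_coboundary 1.
Proof.
move=> gZ; rewrite !inE; split=> [[w E] | [u _ ->]].
  exists (fun v => w (cube_ident v)) => //.
  apply: restrict1_cocycle_inj => //; first exact: cat_cobound_cocycle.
  rewrite E restrict1_cobound; congr cobound.
  by apply/funext=> v; rewrite -cube0E.
by exists (fun v => u (src (val v))); rewrite restrict1_cobound.
Qed.

End Comparison.

Theorem theorem3p10 (k : nat) (L : kgraph k) (A : zmodType) :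
  [/\ (forall f : cochain L A 1, f \in cocycle 1 ->
         exists! ft : cat_fun L A 1, ft \in cat_cocycle 1 /\ restrict1 ft = f),
      (forall g : cat_fun L A 1, g \in cat_cocycle 1 ->
         restrict1 g \in cocycle 1),
      (forall (f : cochain L A 1) (ft : cat_fun L A 1),
         f \in cocycle 1 -> ft \in cat_cocycle 1 -> restrict1 ft = f ->
         (f \in coboundary 1 <-> ft \in cat_coboundary 1))
    & (exists phi : {additive cohomology L A 1 -> cat_cohomology L A 1},
         bijective phi /\
         forall (f : subgrp (@cocycle k L A 1))
                (ft : subgrp (@cat_cocycle k L A 1)),
           restrict1 (val ft) = val f ->
           phi (coh_class f) = cat_coh_class ft)].
Proof.
split.
- move=> f /restrict1_surj[g gZ gf]; exists g; split=> // g' [g'Z g'f].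
  by apply: restrict1_cocycle_inj; rewrite // gf.
- exact: restrict1_cocycle.
- by move=> f ft _ ftZ <-; apply: restrict1_coboundary.
- apply: (subquotient_iso (R := @restrict1 k L A)) => //.
  + exact: restrict1_cocycle.
  + exact: restrict1_surj.
  + exact: restrict1_coboundary.
Qed.
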